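(* Let $n,k,m$ be integers with $2\le k\le n-1$ and $2\le m\le k$, and let $\mathbf a=a_1\cdots a_n$ be a vertex of $G(n)$ contained in at least one closed $k$-walk. Let $y_{\mathbf a}=y_1\cdots y_{n-1}=\mathrm{st}(a_2\cdots a_n)$ and $z_{\mathbf a}=z_1\cdots z_{n-k+1}=\mathrm{st}(a_1\cdots a_{n-k+1})$. Suppose there exist indices $i,j,\ell_1,\dots,\ell_{m-1}$ with $k\le i,j\le n-1$ and $1\le \ell_1,\dots,\ell_{m-1}\le k-1$ such that \[y_i=y_{\ell_1}-1=y_{\ell_2}-2=\cdots=y_{\ell_{m-1}}-(m-1)=y_j-m\] and $z_{i-k+1}+1=z_{n-k+1}=z_{j-k+1}-1$. Then there exist $m$ closed $k$-walks starting at $\mathbf a$ whose second vertices are pairwise distinct.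
   Context: For a sequence of distinct integers $c_1\cdots c_t$, $\mathrm{st}(c_1\cdots c_t)$ is the unique permutation $d_1\cdots d_t$ of $\{1,\dots,t\}$ with $d_i<d_j$ iff $c_i<c_j$. $G(n)$ is the directed multigraph whose vertices are the permutations of $\{1,\dots,n\}$ (one-line notation) and whose edges are the permutations $c_1\cdots c_{n+1}$ of $\{1,\dots,n+1\}$, the edge $c_1\cdots c_{n+1}$ going from $\mathrm{st}(c_1\cdots c_n)$ to $\mathrm{st}(c_2\cdots c_{n+1})$; so there is an edge from $x_1\cdots x_n$ to $w_1\cdots w_n$ iff $\mathrm{st}(x_2\cdots x_n)=\mathrm{st}(w_1\cdots w_{n-1})$. A closed $k$-walk $(v_1,\dots,v_k)$ is a sequence of vertices with an edge from $v_i$ to $v_{i+1}$ for $i<k$ and from $v_k$ to $v_1$. *)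

(* Defs.v *)
From mathcomp Require Import all_boot all_order all_fingroup.

Set Implicit Arguments.
Unset Strict Implicit.
Unset Printing Implicit Defensive.

Import Order.TTheory.

(* The entry st(c)_i is the rank of c_i among the entries of c; lemmas
   [st_perm], [st_mono] and [st_unique] show that on sequences of distinct
   elements this is the standardization. *)
Definition st d (T : orderType d) (c : seq T) : seq nat :=
  [seq count (fun y => (y <= x)%O) c | x <- c].

Definition one_line n (s : 'S_n) : seq nat :=
  [seq (s i).+1 | i <- enum 'I_n].

(* 1-based access: entry s i is s_i for 1 <= i <= size s. *)
Definition entry (s : seq nat) (i : nat) : nat := nth 0 s i.-1.

(* The vertices of G(n) are the elements of 'S_n, its edges those of 'S_n.+1. *)
Definition edge_from_to n (c : 'S_n.+1) (v w : 'S_n) : bool :=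
  (one_line v == st (take n (one_line c))) &&
  (one_line w == st (behead (one_line c))).

Definition adj n : rel 'S_n :=
  fun v w => [exists c : 'S_n.+1, edge_from_to c v w].

Definition closed_walk n k (v : k.-tuple 'S_n) : bool := path.cycle (@adj n) v.

(* v_i, 1-based; the default value is irrelevant for 1 <= i <= k. *)
Definition walk_vertex n k (v : k.-tuple 'S_n) (i : nat) : 'S_n :=
  nth 1%g v i.-1.

Section Standardization.

Variables (d : Order.disp_t) (T : orderType d).
Implicit Types (c : seq T) (e : seq nat).

Lemma size_st c : size (st c) = size c.
Proof. by rewrite size_map. Qed.

Lemma st_mono (x0 : T) c i j : i < size c -> j < size c ->
  (nth 0 (st c) i < nth 0 (st c) j) = (nth x0 c i < nth x0 c j)%O.
Proof.
move=> ic jc; rewrite !(nth_map x0) //.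
have mono x y : (x <= y)%O ->
    count (fun z => (z <= x)%O) c <= count (fun z => (z <= y)%O) c.
  by move=> xy; apply: sub_count => z /= /le_trans; apply.
case: ltP => [xy|yx]; last by rewrite ltnNge mono.
set x := nth x0 c i in xy *; set y := nth x0 c j in xy *.
have yc : 0 < count (pred1 y) c by rewrite -has_count has_pred1 mem_nth.
apply: (@leq_trans (count (predU (fun z => (z <= x)%O) (pred1 y)) c)).
  have := count_predUI (fun z => (z <= x)%O) (pred1 y) c.
  rewrite (@eq_count _ (predI _ _) pred0) ?count_pred0 ?addn0 => [->|z /=].
    by rewrite -addn1 leq_add2l.
  by case: eqP => [->|_]; rewrite ?andbF // leNgt xy.
by apply: sub_count => z /= /orP[zx|/eqP-> //]; apply: le_trans zx (ltW xy).
Qed.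

Lemma st_perm c : uniq c -> perm_eq (st c) (iota 1 (size c)).
Proof.
case: c => [//|x0 c']; set c := x0 :: c' => cU.
have stU : uniq (st c).
  apply/(uniqP 0) => i j; rewrite !inE size_st => ic jc eq_ij.
  apply/eqP; rewrite -(nth_uniq x0 ic jc cU) eq_le !leNgt.
  by rewrite -!st_mono // eq_ij ltnn.
rewrite uniq_perm ?iota_uniq //.
have sub : {subset st c <= iota 1 (size c)}.
  move=> _ /mapP[x xc ->]; rewrite mem_iota add1n ltnS count_size andbT.
  by rewrite -has_count; apply/hasP; exists x.
by have [] := uniq_min_size stU sub; rewrite ?size_iota ?size_st.
Qed.

Lemma st_unique (x0 : T) c e :
  perm_eq e (iota 1 (size c)) ->
  (forall i j, i < size c -> j < size c ->
     (nth 0 e i < nth 0 e j) = (nth x0 c i < nth x0 c j)%O) ->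
  e = st c.
Proof.
move=> eP eM; have sz : size e = size c by rewrite (perm_size eP) size_iota.
apply: (@eq_from_nth _ 0) => [|i]; rewrite sz ?size_st // => ic.
rewrite (nth_map x0) //; set v := nth 0 e i.
have -> : count (fun y => (y <= nth x0 c i)%O) c = count (fun y => y <= v) e.
  rewrite -[in LHS](mkseq_nth x0 c) -[in RHS](mkseq_nth 0 e) !count_map sz.
  apply: eq_in_count => j; rewrite mem_iota /= => jc.
  by rewrite add0n in jc; rewrite mkseq_nth leNgt -(eM i j) // -leqNgt.
have /perm_mem/(_ v) := eP; rewrite mem_nth ?sz // mem_iota add1n ltnS.
move=> /esym/andP[v0 vc]; have /seq.permP-> := eP.
rewrite -(subnKC vc) iotaD count_cat add1n.
rewrite (@eq_in_count _ _ predT) => [|y]; last first.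
  by rewrite mem_iota add1n ltnS => /andP[].
rewrite (@eq_in_count _ _ pred0 (iota v.+1 _)) => [|y]; last first.
  by rewrite mem_iota => /andP[vy _] /=; rewrite leqNgt vy.
by rewrite count_predT count_pred0 size_iota addn0.
Qed.

End Standardization.

(* Main.v *)
(* Closed k-walks from [a] come from sequences [x] of n + k distinct rationals
   whose first n and last n entries both have pattern [a]: the i-th vertex is
   the pattern of the window starting at [x_i]. Lying on a closed k-walk forces
   the first and the last n - k entries of [a] to have the same pattern, so one
   may start from [x_1 ... x_n = a] and append entries one by one. The
   hypothesis on [z] allows [x_(n+1)] to be placed right above [a_(i+1)] as far
   as [a_(k+1) ... a_n] is concerned. The entries [a_(l_r + 1)] that follow
   [a_(i+1)] in value lie outside this window, so [x_(n+1)] may also be put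
   above the first p of them, p < m, and this changes the second vertex. *)
Require Import Defs.
From mathcomp Require Import all_boot all_order all_fingroup.
From mathcomp Require Import all_algebra zify.

Set Implicit Arguments.
Unset Strict Implicit.
Unset Printing Implicit Defensive.

Import Order.TTheory GRing.Theory Num.Theory.

(** * Order patterns of sequences over possibly different ordered types *)

Lemma st_eq_lt d1 (T1 : orderType d1) d2 (T2 : orderType d2) (x1 : T1) (x2 : T2)
    (c1 : seq T1) (c2 : seq T2) i j :
  st c1 = st c2 -> i < size c1 -> j < size c1 ->
  (nth x1 c1 i < nth x1 c1 j)%O = (nth x2 c2 i < nth x2 c2 j)%O.
Proof.
move=> e ic jc; have sz : size c1 = size c2 by rewrite -[LHS]size_st e size_st.
by rewrite -(st_mono x1) // e (st_mono x2) // -sz.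
Qed.

Lemma st_eq d1 (T1 : orderType d1) d2 (T2 : orderType d2) (x1 : T1) (x2 : T2)
    (c1 : seq T1) (c2 : seq T2) :
  uniq c1 -> size c1 = size c2 ->
  (forall i j, i < size c1 -> j < size c1 ->
    (nth x1 c1 i < nth x1 c1 j)%O = (nth x2 c2 i < nth x2 c2 j)%O) ->
  st c1 = st c2.
Proof.
move=> u1 sz e; apply: (st_unique (x0 := x2)); first by rewrite -sz st_perm.
by move=> i j; rewrite -sz => ic jc; rewrite (st_mono x1) // e.
Qed.

Lemma st_rcons d1 (T1 : orderType d1) d2 (T2 : orderType d2) (x1 : T1) (x2 : T2)
    (c1 : seq T1) (c2 : seq T2) q1 q2 :
  uniq (rcons c1 q1) -> uniq (rcons c2 q2) -> st c1 = st c2 ->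
  (forall i, i < size c1 -> (nth x1 c1 i < q1)%O = (nth x2 c2 i < q2)%O) ->
  st (rcons c1 q1) = st (rcons c2 q2).
Proof.
move=> u1 u2 e h; have sz : size c1 = size c2 by rewrite -[LHS]size_st e size_st.
(* The reverse comparisons follow from the assumed ones because neither new entry repeats an old
   one. *)
have gtE i : i < size c1 -> (q1 < nth x1 c1 i)%O = (q2 < nth x2 c2 i)%O.
  move=> ic; move: u1 u2; rewrite !rcons_uniq => /andP[n1 _] /andP[n2 _].
  rewrite !lt_neqAle !leNgt h //; congr (_ && _).
  by rewrite (memPnC n1) ?mem_nth // (memPnC n2) ?mem_nth // -sz.
apply: (st_eq (x1 := x1) (x2 := x2)) => //; first by rewrite !size_rcons sz.
move=> i j; rewrite size_rcons !ltnS !nth_rcons -sz.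
rewrite leq_eqVlt => /predU1P[->|ic]; rewrite leq_eqVlt => /predU1P[->|jc];
  rewrite ?ltnn ?eqxx ?ic ?jc ?ltxx ?h ?gtE //.
exact: st_eq_lt.
Qed.

(** An edge will be the pattern of [n + 1] entries of a longer sequence. This lemma and the next
    turn its end vertices into patterns of windows of that sequence itself. *)
Lemma st_take_st d (T : orderType d) (c : seq T) n :
  uniq c -> st (take n (st c)) = st (take n c).
Proof.
case: c => [|x c' uc]; first by [].
set c := x :: c' in uc *.
apply: (st_eq (x1 := 0) (x2 := x)).
- by rewrite take_uniq // (perm_uniq (st_perm uc)) iota_uniq.
- by rewrite !size_take size_st.
move=> i j; rewrite size_take_min leq_min size_st leq_min.
by move=> /andP[i1 i2] /andP[j1 j2]; rewrite !nth_take //; exact: st_mono.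
Qed.

Lemma st_behead_st d (T : orderType d) (c : seq T) :
  uniq c -> st (behead (st c)) = st (behead c).
Proof.
case: c => [|x c' uc]; first by [].
set c := x :: c' in uc *.
rewrite -!drop1; apply: (st_eq (x1 := 0) (x2 := x)).
- by rewrite drop_uniq // (perm_uniq (st_perm uc)) iota_uniq.
- by rewrite !size_drop size_st.
move=> i j; rewrite size_drop size_st !ltn_subRL => i1 j1.
by rewrite !nth_drop; exact: st_mono.
Qed.

(** * Permutations as one-line words *)

Lemma size_one_line n (s : 'S_n) : size (one_line s) = n.
Proof. by rewrite size_map size_enum_ord. Qed.

Lemma nth_one_line n (s : 'S_n) (i : 'I_n) : nth 0 (one_line s) i = (s i).+1.
Proof. by rewrite (nth_map i) ?size_enum_ord // nth_ord_enum. Qed.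

Lemma one_line_uniq n (s : 'S_n) : uniq (one_line s).
Proof.
rewrite map_inj_uniq ?enum_uniq // => i j [] /val_inj; exact: perm_inj.
Qed.

Lemma one_line_inj n : injective (@one_line n).
Proof.
move=> s t e; apply/permP => i; apply/val_inj/succn_inj.
by rewrite -!nth_one_line e.
Qed.

Lemma one_line_perm_eq n (s : 'S_n) : perm_eq (one_line s) (iota 1 n).
Proof.
have [||_ e] := @uniq_min_size _ (one_line s) (iota 1 n) (one_line_uniq s).
- by move=> _ /mapP[i _ ->]; rewrite mem_iota add1n !ltnS ltn_ord.
- by rewrite size_iota size_one_line.
by apply: uniq_perm; rewrite ?one_line_uniq ?iota_uniq.
Qed.

Lemma st_one_line n (s : 'S_n) : st (one_line s) = one_line s.
Proof.
apply/esym/(st_unique (x0 := 0)) => //.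
by rewrite size_one_line one_line_perm_eq.
Qed.

Lemma st_one_line_ex n d (T : orderType d) (c : seq T) :
  uniq c -> size c = n -> exists s : 'S_n, one_line s = st c.
Proof.
move=> uc sz; have pc := st_perm uc; rewrite sz in pc.
have rng (i : 'I_n) : 0 < nth 0 (st c) i <= n.
  have : nth 0 (st c) i \in iota 1 n.
    by rewrite -(perm_mem pc) mem_nth // size_st sz.
  by rewrite mem_iota add1n ltnS.
have lt (i : 'I_n) : (nth 0 (st c) i).-1 < n.
  by have /andP[h1 h2] := rng i; rewrite prednK.
have f_inj : injective (fun i : 'I_n => Ordinal (lt i)).
  move=> i j [] e; apply/val_inj/eqP.
  have us : uniq (st c) by rewrite (perm_uniq pc) iota_uniq.
  rewrite -(nth_uniq 0 _ _ us) ?size_st ?sz ?ltn_ord //.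
  have /andP[i1 _] := rng i; have /andP[j1 _] := rng j.
  by rewrite -(prednK i1) -(prednK j1) e.
exists (perm f_inj); apply: (@eq_from_nth _ 0) => [|i].
  by rewrite size_one_line size_st.
rewrite size_one_line => ic; rewrite (nth_one_line _ (Ordinal ic)) permE /=.
by rewrite prednK //; have /andP[] := rng (Ordinal ic).
Qed.

(** * Closed walks and sequences with a repeated pattern *)

Lemma adj_lt n (v w : 'S_n) s t : adj v w -> s.+1 < n -> t.+1 < n ->
  (nth 0 (one_line v) s.+1 < nth 0 (one_line v) t.+1)
  = (nth 0 (one_line w) s < nth 0 (one_line w) t).
Proof.
case/existsP=> c /andP[/eqP-> /eqP->] sn tn.
have tk : size (take n (one_line c)) = n by rewrite size_takel ?size_one_line.
have bh : size (behead (one_line c)) = n by rewrite size_behead size_one_line.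
by rewrite !(st_mono 0) ?tk ?bh ?(ltnW sn) ?(ltnW tn) // !nth_take // !nth_behead.
Qed.

Lemma path_adj_lt n (v : 'S_n) p s t : path (@adj n) v p ->
  s + size p < n -> t + size p < n ->
  (nth 0 (one_line v) (s + size p) < nth 0 (one_line v) (t + size p))
  = (nth 0 (one_line (last v p)) s < nth 0 (one_line (last v p)) t).
Proof.
elim: p v => [|w p IH] v /=; first by rewrite !addn0.
case/andP=> vw pw; rewrite !addnS => sn tn.
by rewrite (adj_lt vw) // IH // ltnW.
Qed.

(** Each edge shifts positions by one. Going once around the walk from [a] shifts them by [k] and
    leads back to [a]. *)
Lemma closed_walk_lt n k (v : k.-tuple 'S_n) a s t :
  closed_walk v -> a \in v -> s + k < n -> t + k < n ->
  (nth 0 (one_line a) (s + k) < nth 0 (one_line a) (t + k))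
  = (nth 0 (one_line a) s < nth 0 (one_line a) t).
Proof.
move=> cv av sn tn; have [i p e] := rot_to av.
move: cv; rewrite /closed_walk -(rot_cycle i) e /= => pa.
have sz : k = size (rcons p a).
  by rewrite -(size_tuple v) -(size_rot i) e size_rcons.
by have := @path_adj_lt _ _ _ s t pa; rewrite -sz last_rcons; apply.
Qed.

(** Consecutive windows of length [n] are joined by the edge that is the pattern of the [n + 1]
    entries they cover. The walk closes because the windows at [0] and [k] have the same pattern. *)
Lemma closed_walk_of_seq n k d (T : orderType d) (x : seq T) :
  0 < k -> uniq x -> size x = n + k -> st (take n x) = st (drop k x) ->
  exists v : k.-tuple 'S_n, closed_walk v /\
    forall i, i < k -> one_line (walk_vertex v i.+1) = st (take n (drop i x)).
Proof.
move=> k0 ux sx e.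
have /fin_all_exists[f fE] (i : 'I_k.+1) :
    exists s : 'S_n, one_line s = st (take n (drop i x)).
  apply: st_one_line_ex; first by rewrite take_uniq // drop_uniq.
  rewrite size_takel // size_drop sx -addnBA ?leq_addr //.
  by rewrite -ltnS.
pose g i := f (inord i).
have gE i : i <= k -> one_line (g i) = st (take n (drop i x)).
  by move=> ik; rewrite fE inordK.
have gk : g k = g 0.
  apply: one_line_inj; rewrite !gE // drop0 e take_oversize //.
  by rewrite size_drop sx addnK.
have g_adj i : i < k -> adj (g i) (g i.+1).
  move=> ik; have uw : uniq (take n.+1 (drop i x)) by rewrite take_uniq ?drop_uniq.
  have [||c cE] := @st_one_line_ex n.+1 _ _ (take n.+1 (drop i x)) => //.
    by rewrite size_takel // size_drop sx ltn_subRL addnC ltn_add2l.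
  apply/existsP; exists c; rewrite /edge_from_to cE (gE _ (ltnW ik)) (gE _ ik).
  rewrite st_take_st // st_behead_st // take_takel // -!drop1.
  by rewrite -[n.+1]addn1 -take_drop drop_drop add1n !eqxx.
have sz : size (mkseq g k) == k by rewrite size_mkseq.
exists (Tuple sz); split=> [|i ik]; last first.
  by rewrite /walk_vertex /= nth_mkseq // gE // ltnW.
rewrite /closed_walk /= (cycle_path 1%g); apply/(pathP 1%g) => i.
rewrite size_mkseq => ik; rewrite nth_mkseq //.
(* Index [0] is the closing edge, from [g k.-1] to [g 0 = g k]. *)
case: i ik => [|i] ik /=; last by rewrite nth_mkseq ?g_adj // ltnW.
rewrite -nth_last size_mkseq nth_mkseq ?prednK // -gk.
by rewrite -{2}(prednK k0) g_adj // prednK.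
Qed.

(** * Inserting rationals at prescribed places *)

Lemma rat_gap (l : rat) (F : seq rat) :
  exists2 q, (l < q)%R & forall u, u \in F -> (l < u)%R -> (q < u)%R.
Proof.
elim: F => [|f F [q lq h]]; first by exists (l + 1)%R; rewrite ?ltrDl.
have [lf|fl] := ltP l f; last first.
  exists q => // u; rewrite inE => /predU1P[->|/h //].
  by rewrite ltNge fl.
have lm : (l < Num.min f q)%R by rewrite lt_min lf.
have [lc] := midf_lt lm; rewrite lt_min; set c := (_ / _)%R => /andP[cf cq].
exists c => // u; rewrite inE => /predU1P[->//|uF lu].
by rewrite (lt_trans cq) ?h.
Qed.

(** A threshold [l] is found first, with the entries satisfying [P] at most [l] and the others above
    it. Then [q] is taken above [l] but below every entry of [F ++ s] exceeding [l]. *)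
Lemma rat_cut (s F : seq rat) (P : pred rat) :
  {in s &, forall u v, P u -> ~~ P v -> (u < v)%R} ->
  exists2 q, q \notin F ++ s & {in s, forall u, (u < q)%R = P u}.
Proof.
move=> h; have [l lP lN] : exists2 l : rat, {in s, forall u, P u -> (u <= l)%R} &
    {in s, forall u, ~~ P u -> (l < u)%R}.
  elim: s h => [|x s IH] h; first by exists 0%R.
  have [|l lP lN] := IH; first by move=> u v us vs; apply: h; rewrite inE ?us ?vs orbT.
  have [Px|Px] := boolP (P x).
    exists (Num.max x l) => u; rewrite inE => /predU1P[->|us].
    - by rewrite le_max lexx.
    - by move=> /(lP _ us) ul; rewrite le_max ul orbT.
    - by rewrite Px.
    by move=> Pu; rewrite gt_max lN // h ?inE ?eqxx ?us ?orbT.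
  have [lx|xl] := ltP l x.
    exists l => u; rewrite inE => /predU1P[->|]; rewrite ?(negPf Px) //.
      exact: lP.
    exact: lN.
  (* Here [x] fails [P] but [x <= l], so the threshold must drop below [x] and stay above the
     entries satisfying [P]. This is [rat_gap] for the negated values. *)
  have [q qx qs] := rat_gap (- x)%R [seq - u | u <- s & P u]%R.
  exists (- q)%R => u; rewrite inE => /predU1P[->|us].
  - by rewrite (negPf Px).
  - move=> Pu; rewrite lerNr ltW // qs // ?map_f ?mem_filter ?Pu //.
    by rewrite ltrN2 h // inE ?eqxx ?us ?orbT.
  - by rewrite ltrNl.
  by move=> Pu; rewrite (lt_le_trans _ (le_trans xl (ltW (lN _ us Pu)))) // ltrNl.
have [q lq qF] := rat_gap l (F ++ s).
exists q => [|u us].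
  by apply/negP => /qF/(_ lq); rewrite ltxx.
case: (boolP (P u)) => Pu; first by rewrite (le_lt_trans (lP _ us Pu)).
by apply/negbTE; rewrite -leNgt ltW // qF ?lN // mem_cat us orbT.
Qed.

(** Entries are appended one by one, each realizing a cut of those already present. [F] holds values
    outside the window that must not be repeated. *)
Lemma st_extend (b : seq nat) (F s : seq rat) :
  uniq b -> uniq (F ++ s) -> size s <= size b -> st s = st (take (size s) b) ->
  exists2 e, uniq (F ++ s ++ e) & st (s ++ e) = st b.
Proof.
move=> ub; move: {2}(size b - size s) (erefl (size b - size s)) => r.
elim: r s => [|r IH] s dr us sb e.
  exists [::]; rewrite cats0 // e take_oversize //.
  by rewrite -subn_eq0 dr.
have sb' : size s < size b by rewrite -subn_gt0 dr.
(* [P] selects the entries of [s] whose counterparts in [b] lie below the next entry of [b]. *)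
pose P u := nth 0 b (index u s) < nth 0 b (size s).
have nb i : i < size s -> nth 0 b i = nth 0 (take (size s) b) i.
  by move=> it; rewrite nth_take.
have [u v uI vI Pu Pv|q qN qP] := @rat_cut s F P.
  rewrite -(nth_index 0%R uI) -(nth_index 0%R vI).
  rewrite (st_eq_lt _ 0 e) ?index_mem // -!nb ?index_mem //.
  by apply: leq_trans Pu _; rewrite leqNgt.
have [||||f fU fE] := IH (rcons s q).
- by rewrite size_rcons subnS dr.
- by rewrite -rcons_cat rcons_uniq qN.
- by rewrite size_rcons.
- rewrite size_rcons (take_nth 0) //.
  have us' : uniq s by move: us; rewrite cat_uniq => /and3P[].
  apply: (st_rcons (x1 := 0%R) (x2 := 0)) => //.
  + by rewrite rcons_uniq us' andbT; apply: contra qN; rewrite mem_cat orbC => ->.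
  + by rewrite -take_nth // take_uniq.
  by move=> i it; rewrite qP ?mem_nth // /P index_uniq // nth_take.
by exists (q :: f); rewrite -cat_rcons.
Qed.

(** * Construction of the [m] walks and separation of their second vertices *)

Theorem theorem3p10 (n k m : nat)
    (hk : 2 <= k <= n - 1) (hm : 2 <= m <= k)
    (a : 'S_n)
    (ha : exists v : k.-tuple 'S_n, closed_walk v /\ a \in v)
    (y z : seq nat)
    (hy : y = st (behead (one_line a)))
    (hz : z = st (take (n - k + 1) (one_line a)))
    (i j : nat) (l : nat -> nat)
    (hi : k <= i <= n - 1) (hj : k <= j <= n - 1)
    (hl : forall r : nat, 1 <= r <= m - 1 -> 1 <= l r <= k - 1)
    (hyl : forall r : nat, 1 <= r <= m - 1 -> entry y (l r) = entry y i + r)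
    (hyj : entry y j = entry y i + m)
    (hzi : entry z (i - k + 1) + 1 = entry z (n - k + 1))
    (hzj : entry z (n - k + 1) + 1 = entry z (j - k + 1)) :
  exists W : 'I_m -> k.-tuple 'S_n,
    (forall p : 'I_m, closed_walk (W p) /\ walk_vertex (W p) 1 = a) /\
    injective (fun p : 'I_m => walk_vertex (W p) 2).
Proof.
have [v [cv av]] := ha; have period := closed_walk_lt cv av.
have /andP[k2 kn1] := hk; have /andP[ki in1] := hi.
have kn : k < n by lia.
set o := one_line a in hy hz period.
have so : size o = n by exact: size_one_line.
have uo : uniq o by exact: one_line_uniq.
have sy : size y = n.-1 by rewrite hy size_st size_behead so.
have uy : uniq y.
  by rewrite hy (perm_uniq (st_perm _)) ?iota_uniq // -drop1 drop_uniq.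
(* [y_s] ranks [a_(s+1)], which is [nth 0 o s]: the shift by [behead] cancels the change from
   1-based to 0-based indices. *)
have yE s t : 0 < s < n -> 0 < t < n ->
    (entry y s < entry y t) = (nth 0 o s < nth 0 o t).
  case: s t => [|s] [|t] //= sn tn.
  by rewrite /entry hy (st_mono 0) ?size_behead ?so ?nth_behead //; lia.
have zE s t : s <= n - k -> t <= n - k ->
    (entry z (s + 1) < entry z (t + 1)) = (nth 0 o s < nth 0 o t).
  move=> sn tn.
  by rewrite hz /entry !addn1 (st_mono 0) ?size_takel ?so ?nth_take //; lia.
(* The entries of [a] become rationals so that there is room between neighbouring values. *)
pose x : seq rat := map (fun u => u%:R)%R o.
have sx : size x = n by rewrite size_map.
have ux : uniq x by rewrite map_inj_uniq //; exact: mulrIn.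
have xE s t : s < n -> t < n -> (nth 0 x s < nth 0 x t)%R = (nth 0 o s < nth 0 o t).
  by move=> sn tn; rewrite !(nth_map 0) ?so // ltr_nat.
have stx : st x = o.
  rewrite -[RHS]st_one_line; apply: (st_eq (x1 := 0%R) (x2 := 0)) => [//||s t].
    by rewrite sx so.
  by rewrite sx; exact: xE.
(* [y_(lam p) = y_i + p]; the new entry of the [p]-th walk goes just above
   [a_(lam p + 1)], which is [nth 0 x (lam p)] as lists are indexed from 0. *)
pose lam p := if p is 0 then i else l p.
have lamE p : p < m -> entry y (lam p) = entry y i + p.
  by case: p => [|p] pm; rewrite ?addn0 // hyl //; lia.
have lam_bd p : p < m -> 1 <= lam p <= n - 1.
  case: p => [|p] pm; first by rewrite /lam; lia.
  have := hl p.+1; rewrite /lam; lia.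
have gap p : p < m -> exists2 q, q \notin x &
    forall t, 0 < t < n -> (nth 0 x t < q)%R = (entry y t <= entry y i + p).
  move=> pm; pose c := nth 0%R x (lam p).
  (* The first entry lies outside the second window, so [q] is not compared with it and only has to
     differ from it. *)
  have [u w _ _ uc|q qN qP] := @rat_cut (behead x) (take 1 x) (fun u => u <= c)%R.
    by rewrite -ltNge; exact: le_lt_trans.
  exists q => [|t /andP[t0 tn]].
    by rewrite -drop1 cat_take_drop in qN.
  have lb := lam_bd p pm.
  rewrite qP; last by rewrite -[t]prednK // -nth_behead mem_nth // size_behead sx; lia.
  rewrite leNgt xE ?sx //; last by lia.
  by rewrite -yE ?lamE -?leqNgt //; lia.
(* The position of [q] is kept with the walk, since it will separate the second vertices. *)
have walk (p : 'I_m) : exists w : k.-tuple 'S_n,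
    [/\ closed_walk w, walk_vertex w 1 = a & exists2 q,
      one_line (walk_vertex w 2) = st (rcons (behead x) q) &
      forall t, 0 < t < n -> (nth 0 x t < q)%R = (entry y t <= entry y i + p)].
  have [q qN qP] := gap p (ltn_ord p).
  have ud : uniq (rcons (drop k x) q).
    by rewrite rcons_uniq drop_uniq // andbT (contra _ qN) //; exact: mem_drop.
  (* The last window starts with [a_(k+1), ..., a_n, q], which must have the pattern of
     [a_1, ..., a_(n-k+1)]. The remaining [k - 1] entries [e] complete it to the pattern of [a]. *)
  have [||||e eU eE] := @st_extend o (take k x) (rcons (drop k x) q).
  - exact: uo.
  - by rewrite -rcons_cat cat_take_drop rcons_uniq qN.
  - by rewrite size_rcons size_drop sx so; lia.
  - rewrite size_rcons size_drop sx (take_nth 0) ?so; last by lia.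
    apply: (st_rcons (x1 := 0%R) (x2 := 0)) => //.
    + by rewrite -take_nth ?so ?take_uniq //; lia.
    + apply: (st_eq (x1 := 0%R) (x2 := 0)); first exact: drop_uniq.
        by rewrite size_take_min size_drop sx so; lia.
      move=> s t; rewrite size_drop sx => sn tn.
      by rewrite !nth_drop !nth_take // xE ?[k + _]addnC ?period //; lia.
    rewrite size_drop sx => t tn; rewrite nth_drop qP; last by lia.
    (* No entry of [y] at an index [>= k] has value [y_i + r] with [0 < r <= p]. *)
    have -> : (entry y (k + t) <= entry y i + p) = (entry y (k + t) <= entry y i).
      apply/idP/idP => [le|]; last by lia.
      rewrite leqNgt; apply/negP => gt; have pm := ltn_ord p.
      pose r := entry y (k + t) - entry y i.
      have rm : 1 <= r <= m - 1 by rewrite /r; lia.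
      have lr := hl r rm.
      suff : (l r).-1 = (k + t).-1 by lia.
      apply/eqP; rewrite -(nth_uniq 0 _ _ uy) ?sy; try lia.
      by apply/eqP; rewrite -!/(entry _ _) hyl // /r; lia.
    (* By the shift by [k], [a_(k+t+1) <= a_(i+1)] iff [a_(t+1) <= a_(i-k+1)]. As [z_(n-k+1)] is the
       next value after [z_(i-k+1)], this means [a_(t+1) < a_(n-k+1)]. *)
    rewrite leqNgt yE; try lia.
    rewrite -[i in nth 0 o i](subnK ki) [k + t]addnC period; try lia.
    by rewrite nth_take // ltEnat /= -!zE; lia.
  set s := rcons _ _ in eU eE.
  (* The same sequence is read in two ways: its first [n] entries are [x], its last [n] are
     [s ++ e], and both have pattern [a]. *)
  have XE : x ++ q :: e = take k x ++ s ++ e.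
    by rewrite /s -cats1 -!catA catA cat_take_drop.
  clearbody s.
  have se : size (s ++ e) = n by rewrite -size_st eE size_st.
  have dX : drop k (x ++ q :: e) = s ++ e.
    by rewrite XE drop_size_cat // size_takel // sx ltnW.
  have [//||||w [cw wE]] := @closed_walk_of_seq n k _ _ (x ++ q :: e).
  - by lia.
  - by rewrite XE.
  - by rewrite XE size_cat se size_takel ?sx; [exact: addnC|exact: ltnW].
  - by rewrite dX eE st_one_line take_size_cat.
  exists w; split=> //.
    by apply: one_line_inj; rewrite wE ?drop0 ?take_size_cat // ltnW.
  exists q => //; rewrite wE // drop_cat sx -drop1 -cats1; have -> : 1 < n by lia.
  rewrite -[q :: e]/([:: q] ++ e) catA take_size_cat //.
  by rewrite size_cat size_drop sx /=; lia.
have [W WE] := fin_all_exists walk.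
exists W; split=> [p|]; first by have [] := WE p.
(* For [p < p'], the entry [a_(lam p' + 1)] has rank [y_i + p'] in [y], so it lies below the last
   entry of the second window for [p'] but not for [p]. *)
have neq (p p' : 'I_m) : p < p' -> walk_vertex (W p) 2 <> walk_vertex (W p') 2.
  move=> pp' e; have [_ _ [q qE qP]] := WE p; have [_ _ [q' qE' qP']] := WE p'.
  have lb := lam_bd p' (ltn_ord p').
  have sr (u : rat) : size (rcons (behead x) u) = n.
    by rewrite size_rcons size_behead sx; lia.
  have nr (u : rat) : nth 0%R (rcons (behead x) u) (lam p').-1 = nth 0%R x (lam p').
    by rewrite nth_rcons size_behead sx ifT ?nth_behead ?prednK //; lia.
  have nl (u : rat) : nth 0%R (rcons (behead x) u) n.-1 = u.
    by rewrite nth_rcons size_behead sx ltnn eqxx.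
  have ee : st (rcons (behead x) q) = st (rcons (behead x) q') by rewrite -qE e.
  have lt1 : (lam p').-1 < n by lia.
  have lt2 : n.-1 < n by lia.
  have := st_eq_lt 0%R 0%R ee (i := (lam p').-1) (j := n.-1).
  rewrite !sr !nr !nl => /(_ lt1 lt2); have lb' : 0 < lam p' < n by lia.
  by rewrite (qP _ lb') (qP' _ lb') lamE // !leq_add2l leqnn leqNgt pp'.
move=> p p' e; apply/val_inj; case: (ltngtP p p') => // /neq; [by case|by rewrite e].
Qed.
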